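(* Let $R$ be a finite commutative ring, let $s>1$ be an integer, and let $\Omega\subseteq\overline{R^k}$ be stable under multiplication by $R^\times$ and generate $R^k$. Then: \begin{itemize} \item $\Omega$ is an $s$-sum set if and only if $\Gamma(\Omega)$ is an $s$-SWRG; \item $\Omega\cup\{0\}$ is an $s$-sum set if and only if $\Gamma(\Omega)^1$ is an $s$-SWRG. \end{itemize}
   Context: $\overline{R^k}=\{\omega\in R^k : \{\omega\cdot x : x\in R^k\}=R\}$ is the set of regular vectors, where $\cdot$ is the standard inner product. $\Gamma(\Omega)$ is the syndrome graph of the code with check matrix $H$, where the columns of $H$ are representatives of $\Omega$ modulo multiplication by $R^\times$: its vertices are the syndromes $Hx$, and two vertices are adjacent iff they differ by a unit multiple of a column of $H$. Since $\Omega$ is unit-stable and generates $R^k$, it is the Cayley graph on $(R^k,+)$ with connection set $\Omega$. $\Gamma(\Omega)^1$ is obtained by adding one loop at every vertex. A set $\Omega'\subseteq R^k$ is an $s$-sum set if it is stable under multiplication by units of $R$ and there are integer constants $\sigma_0,\sigma_1$ such that every nonzero $h\in R^k$ can be written as $h=\sum_{i=1}^s x_i$ with $(x_1,\dots,x_s)\in\Omega'^s$ in exactly $\sigma_0$ ways if $h\in\Omega'$ and in exactly $\sigma_1$ ways if $h\notin\Omega'$. A graph (possibly with loops) is an $s$-SWRG (strongly walk-regular graph) if there are integers $\lambda,\mu,\nu$ such that the number of walks of length $s$ from $x$ to $y$ is $\lambda$ if $x\neq y$ are adjacent, $\mu$ if $x\ne y$ are non-adjacent, and $\nu$ if $x=y$.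 *)

(* Defs.v *)
From HB Require Import structures.
From mathcomp Require Import all_boot all_order all_algebra.

Set Implicit Arguments.
Unset Strict Implicit.
Unset Printing Implicit Defensive.

Import GRing.Theory.
Local Open Scope ring_scope.

(* [adj x x] means that x carries a loop; parallel edges and multiple loops are
   not represented. *)
Record loop_graph := LoopGraph {
  vertex :> finType;
  adj : rel vertex;
  adj_sym : symmetric adj
}.

Section Graphs.
Variable G : loop_graph.

Definition walks (s : nat) (x y : G) : {set s.-tuple G} :=
  [set p : s.-tuple G | path (@adj G) x p && (last x p == y)].

Definition swrg (s : nat) : Prop :=
  exists lambda mu nu : int, forall x y : G,
    [/\ x != y -> adj x y -> #|walks s x y| = lambda :> int,
        x != y -> ~~ adj x y -> #|walks s x y| = mu :> int
      & x = y -> #|walks s x y| = nu :> int].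

Definition loops_adj : rel G := fun x y => (x == y) || adj x y.

Lemma loops_adj_sym : symmetric loops_adj.
Proof. by move=> x y; rewrite /loops_adj eq_sym adj_sym. Qed.

Definition add_loops : loop_graph := LoopGraph loops_adj_sym.

End Graphs.

(* [GRing.unit] would require 1 != 0; the zero ring is not excluded here. *)
Definition units (R : finComPzRingType) : {set R} :=
  [set u : R | [exists v : R, u * v == 1]].

Section Vectors.
Variables (R : finComPzRingType) (k : nat).
Implicit Types (Omega : {set 'cV[R]_k}) (h w : 'cV[R]_k).

Definition dot w h : R := \sum_(i < k) w i 0 * h i 0.

Definition regular_vectors : {set 'cV[R]_k} :=
  [set w : 'cV[R]_k | [set dot w x | x : 'cV[R]_k] == [set: R]].

Definition unit_stable Omega : Prop :=
  forall u w, u \in units R -> w \in Omega -> u *: w \in Omega.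

(* Generation as an R-module, not merely as an additive group. *)
Definition generates Omega : Prop :=
  forall h, exists c : 'cV[R]_k -> R, h = \sum_(w in Omega) c w *: w.

Definition decompositions (s : nat) Omega h : {set s.-tuple 'cV[R]_k} :=
  [set x : s.-tuple 'cV[R]_k
     | [forall i, tnth x i \in Omega] && (\sum_(i < s) tnth x i == h)].

Definition sum_set (s : nat) Omega : Prop :=
  unit_stable Omega /\
  exists sigma0 sigma1 : int, forall h, h != 0 ->
    (h \in Omega -> #|decompositions s Omega h| = sigma0 :> int) /\
    (h \notin Omega -> #|decompositions s Omega h| = sigma1 :> int).

(* The columns of H represent Omega modulo multiplication by units, each class
   being represented by exactly one column. *)
Definition check_matrix_of Omega (n : nat) (H : 'M[R]_(k, n)) : Prop :=
  (forall j, col j H \in Omega) /\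
  (forall w, w \in Omega ->
     exists! j : 'I_n, exists2 u, u \in units R & w = u *: col j H).

Section SyndromeGraph.
Variables (n : nat) (H : 'M[R]_(k, n)).

Definition syndromes : {set 'cV[R]_k} := [set H *m x | x : 'cV[R]_n].

Definition syndrome_adj : rel {h : 'cV[R]_k | h \in syndromes} :=
  fun x y => [exists u in units R, exists j, val x - val y == u *: col j H].

Lemma syndrome_adj_sym : symmetric syndrome_adj.
Proof.
suff sub x y : syndrome_adj x y -> syndrome_adj y x.
  by move=> x y; apply/idP/idP; apply: sub.
case/exists_inP=> u; rewrite inE => /existsP[v /eqP uv] /existsP[j /eqP E].
apply/exists_inP; exists (- u).
  by rewrite inE; apply/existsP; exists (- v); rewrite mulrNN uv.
by apply/existsP; exists j; rewrite -opprB E scaleNr.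
Qed.

Definition syndrome_graph : loop_graph := LoopGraph syndrome_adj_sym.

End SyndromeGraph.

Lemma check_matrix_exists Omega :
  unit_stable Omega -> exists n (H : 'M[R]_(k, n)), check_matrix_of Omega H.
Proof.
move=> stab.
pose assoc (w : 'cV[R]_k) :=
  [pred v : 'cV[R]_k | [exists u in units R, w == u *: v]].
have uinv u : u \in units R -> exists2 v, v \in units R & v * u = 1.
  rewrite inE => /existsP[v /eqP uv]; exists v; last by rewrite mulrC.
  by rewrite inE; apply/existsP; exists u; rewrite mulrC uv.
have umul u v : u \in units R -> v \in units R -> u * v \in units R.
  rewrite !inE => /existsP[a /eqP ua] /existsP[b /eqP vb].
  by apply/existsP; exists (a * b); rewrite mulrACA ua vb mulr1.
have u1 : 1 \in units R by rewrite inE; apply/existsP; exists 1; rewrite mulr1.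
have arefl w : assoc w w by apply/exists_inP; exists 1; rewrite ?scale1r.
have asym v w : assoc v w -> assoc w v.
  case/exists_inP=> u uU /eqP->; have [a aU au] := uinv _ uU.
  by apply/exists_inP; exists a; rewrite // scalerA au scale1r.
have atrans v w z : assoc v w -> assoc w z -> assoc v z.
  case/exists_inP=> u uU /eqP-> /exists_inP[a aU /eqP->].
  by apply/exists_inP; exists (u * a); rewrite ?umul // scalerA.
pose r w := choose (assoc w) w.
have rP w : assoc w (r w) by apply: chooseP.
have req v w : assoc v w -> r v = r w.
  move=> vw; rewrite /r (@eq_choose _ (assoc v) (assoc w)).
    by apply: choose_id => //; apply: asym.
  by move=> z; apply/idP/idP; apply: atrans => //; apply: asym.
pose P := r @: Omega; pose H := \matrix_(i < k, j < #|P|) (enum_val j) i 0.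
have colH j : col j H = enum_val j.
  by apply/matrixP => i z; rewrite !mxE (ord1 z).
have rin w : w \in Omega -> r w \in Omega.
  by move=> wO; have /asym/exists_inP[u uU /eqP->] := rP w; apply: stab.
exists #|P|, H; split=> [j|w wO].
  by rewrite colH; have /imsetP[w wO ->] := enum_valP j; apply: rin.
have rwP : r w \in P by apply: imset_f.
exists (enum_rank_in rwP (r w)); split.
  by rewrite colH enum_rankK_in //; have /exists_inP[u uU /eqP E] := rP w; exists u.
move=> j [u uU]; rewrite colH => E; apply: enum_val_inj; rewrite enum_rankK_in //.
have wj : assoc w (enum_val j) by apply/exists_inP; exists u; rewrite -?E.
rewrite (req _ _ wj); have /imsetP[z zO ->] := enum_valP j.
by apply/esym; apply: req; apply: rP.
Qed.

End Vectors.

(* Main.v *)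
Require Import Defs.
From mathcomp Require Import all_boot all_order all_algebra.

(** The theorem holds because both sides count the same thing.  The columns of
    [H] generate the module, so the syndromes are all the vectors, and two
    syndromes are adjacent exactly when their difference lies in [Omega]: the
    syndrome graph is the Cayley graph of [Omega], and adding the loops amounts
    to adjoining [0] to the connection set.  In a Cayley graph, recording the
    successive steps turns walks of length [s] from [x] to [y] bijectively into
    the ordered decompositions of [y - x] into [s] elements of the connection
    set ([card_walks_cayley]).  The number of walks thus depends only on the
    difference of the end points, and the two definitions become the same
    condition ([sum_set_cayley]): distinct end points have a nonzero difference,
    which lies in the connection set exactly when they are adjacent, while the
    constant [nu] for closed walks always exists, being the number of decompositions of [0]. *)

Set Implicit Arguments.
Unset Strict Implicit.
Unset Printing Implicit Defensive.

Import GRing.Theory.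
Local Open Scope ring_scope.

Section Cayley.
Variables (R : finComPzRingType) (k : nat) (O : {set 'cV[R]_k}).
Variables (G : loop_graph) (f : G -> 'cV[R]_k) (g : 'cV[R]_k -> G).
Hypotheses (fK : cancel f g) (gK : cancel g f).
Hypothesis adjE : forall x y : G, adj x y = (f y - f x \in O).

Let step (x y : G) := f y - f x.

Lemma path_steps (x : G) (p : seq G) :
  path (@adj G) x p = all [in O] (pairmap step x p).
Proof. by elim: p x => //= y p IHp x; rewrite adjE IHp. Qed.

Lemma sum_steps (x : G) (p : seq G) :
  \sum_(d <- pairmap step x p) d = f (last x p) - f x.
Proof.
elim: p x => [|y p IHp] x /=; first by rewrite big_nil subrr.
by rewrite big_cons IHp addrC addrA subrK.
Qed.

Lemma in_decompositions (s : nat) (h : 'cV[R]_k) (t : s.-tuple 'cV[R]_k) :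
  (t \in decompositions s O h) = all [in O] t && (\sum_(d <- t) d == h).
Proof.
rewrite inE big_tuple; congr (_ && _).
by apply/forallP/all_tnthP.
Qed.

(** A walk is determined by its starting point and its steps, and every
    sequence of steps can be walked: the inverse map takes partial sums. *)
Lemma card_walks_cayley (s : nat) (x y : G) :
  #|walks s x y| = #|decompositions s O (f y - f x)|.
Proof.
pose D (p : s.-tuple G) := [tuple of pairmap step x p].
pose W (t : s.-tuple 'cV[R]_k) :=
  [tuple of scanl (fun (z : G) d => g (f z + d)) x t].
have DK : cancel D W.
  move=> p; apply: val_inj; apply: pairmapK => z u.
  by rewrite /step addrC subrK fK.
have WK : cancel W D.
  move=> t; apply: val_inj; apply: scanlK => z d.
  by rewrite /step gK addrC addKr.
have -> : walks s x y = D @^-1: decompositions s O (f y - f x).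
  apply/setP=> p; rewrite in_set inE in_decompositions path_steps sum_steps.
  by rewrite (inj_eq (addIr _)) (inj_eq (can_inj fK)).
by apply: on_card_preimset; exists W => ? _; [apply: DK | apply: WK].
Qed.

Lemma sum_set_cayley (s : nat) :
  unit_stable O -> (sum_set s O <-> swrg G s).
Proof.
move=> stab; split=> [[_ [s0 [s1 Hs]]]|[la [mu [nu Hw]]]].
  exists s0, s1, (Posz #|decompositions s O 0|) => x y.
  rewrite card_walks_cayley adjE.
  have nz : x != y -> f y - f x != 0.
    by rewrite subr_eq0 eq_sym (inj_eq (can_inj fK)).
  split=> [/nz/Hs[]|/nz/Hs[]|->] //.
  by rewrite subrr.
split=> //; exists la, mu => h h0.
have ne : g 0 != g h by rewrite eq_sym (inj_eq (can_inj gK)).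
have [adjP nadjP _] := Hw (g 0) (g h).
move: adjP nadjP; rewrite card_walks_cayley adjE !gK subr0 => adjP nadjP.
by split=> [/(adjP ne)|/(nadjP ne)].
Qed.

End Cayley.

Section Units.
Variables (R : finComPzRingType) (k : nat) (Omega : {set 'cV[R]_k}).
Hypothesis stab : unit_stable Omega.

Lemma unit_stable_opp (w : 'cV[R]_k) : (- w \in Omega) = (w \in Omega).
Proof.
have N1 : -1 \in units R.
  by rewrite inE; apply/existsP; exists (-1); rewrite mulrNN mulr1.
have sub v : v \in Omega -> - v \in Omega by move/(stab N1); rewrite scaleN1r.
by apply/idP/idP => /sub //; rewrite opprK.
Qed.

Lemma unit_stable_setU0 : unit_stable (0 |: Omega).
Proof.
move=> u w uU /setU1P[->|wO]; first by rewrite scaler0 setU11.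
by rewrite setU1r // stab.
Qed.

Variables (n : nat) (H : 'M[R]_(k, n)).
Hypothesis HO : check_matrix_of Omega H.

Lemma syndrome_adjE (x y : syndrome_graph H) :
  adj x y = (val y - val x \in Omega).
Proof.
rewrite -unit_stable_opp opprB; have [colO repO] := HO.
apply/exists_inP/idP => [[u uU /existsP[j /eqP->]]|].
  exact: stab (colO j).
case/repO=> j [[u uU E] _]; exists u => //.
by apply/existsP; exists j; apply/eqP.
Qed.

Lemma syndromes_full (h : 'cV[R]_k) : generates Omega -> h \in syndromes H.
Proof.
move=> /(_ h)[c ->]; have [_ repO] := HO.
(* The syndromes form a submodule, so it suffices to reach each generator. *)
elim/big_ind: _ => [|_ _ /imsetP[a _ ->] /imsetP[b _ ->]|w /repO].
- by apply/imsetP; exists 0; rewrite // mulmx0.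
- by apply/imsetP; exists (a + b); rewrite // mulmxDr.
move: (c w) => a [j [[u _ ->] _]]; apply/imsetP.
exists ((a * u) *: delta_mx j 0) => //.
by rewrite -scalemxAr -colE scalerA.
Qed.

End Units.

Theorem theorem2 (R : finComPzRingType) (k s : nat) (Omega : {set 'cV[R]_k})
    (n : nat) (H : 'M[R]_(k, n)) :
  (1 < s)%N ->
  Omega \subset regular_vectors R k ->
  unit_stable Omega ->
  generates Omega ->
  check_matrix_of Omega H ->
  (sum_set s Omega <-> swrg (syndrome_graph H) s) /\
  (sum_set s (0%R |: Omega) <-> swrg (add_loops (syndrome_graph H)) s).
Proof.
move=> _ _ stab gen HO.
pose g h : syndrome_graph H := Sub h (syndromes_full HO h gen).
have valK : cancel val g by move=> x; apply: val_inj; rewrite SubK.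
have gK : cancel g val by move=> h; rewrite SubK.
have adjO := syndrome_adjE stab HO.
split.
  exact: (@sum_set_cayley _ _ _ (syndrome_graph H) _ _ valK gK adjO s stab).
apply: (@sum_set_cayley R k _ (add_loops (syndrome_graph H)) val g) => //.
  move=> x y; rewrite in_setU1 subr_eq0 -adjO.
  by rewrite (inj_eq val_inj) eq_sym.
exact: unit_stable_setU0.
Qed.
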